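(* Let $\mu$ be an $L$-subgroup of $G$ and let $\eta\in L(\mu)$ be such that $\mu$ and $\eta$ are jointly supstar. Suppose $\eta$ is a maximal $L$-subgroup of $\mu$ and $\eta(e)=\mu(e)$. Then there exists exactly one $a_0\in\mathrm{Im}\,\mu$ such that $\eta_{a_0}$ is a maximal subgroup of $\mu_{a_0}$, and for all other $a\in\mathrm{Im}\,\mu\cup\mathrm{Im}\,\eta$ one has $\eta_a=\mu_a$.
   Context: $L$ is a completely distributive (complete) lattice with least element $0$ and greatest element $1$; $G$ is a group with identity $e$. An $L$-subset of $G$ is a function $G\to L$; $\eta\subseteq\mu$ means $\eta(x)\le\mu(x)$ for all $x\in G$. $\mathrm{Im}\,\mu=\{\mu(x): x\in G\}$, and for $a\in L$ the level subset is $\mu_a=\{x\in G:\mu(x)\ge a\}$. An $L$-subset $\mu$ of $G$ is an $L$-subgroup of $G$ if $\mu(xy)\ge\mu(x)\wedge\mu(y)$ and $\mu(x^{-1})=\mu(x)$ for all $x,y\in G$; its non-empty level subsets are subgroups of $G$. For an $L$-subgroup $\mu$ of $G$, $L(\mu)$ denotes the set of $L$-subgroups $\eta$ of $G$ with $\eta\subseteq\mu$ (called $L$-subgroups of $\mu$). An $\eta\in L(\mu)$ is proper if $\eta$ is non-constant and $\eta\neq\mu$. A proper $L$-subgroup $\eta$ of $\mu$ is a maximal $L$-subgroup of $\mu$ if whenever $\eta\subseteq\theta\subseteq\mu$ with $\theta\in L(\mu)$, then $\theta=\eta$ or $\theta=\mu$. A non-empty subset $X$ of $L$ is a supstar subset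 if every non-empty subset $A$ of $X$ contains its supremum. Two $L$-subsets $\eta,\theta$ are jointly supstar if $\mathrm{Im}\,\eta\cup\mathrm{Im}\,\theta$ is a supstar subset of $L$. *)

(* Defs.v *)
From HB Require Import structures.
From mathcomp Require Import all_boot all_order.
From mathcomp Require Import monoid.
From mathcomp Require Import boolp classical_sets.

Set Implicit Arguments.
Unset Strict Implicit.
Unset Printing Implicit Defensive.

Import Order.TTheory.

Local Open Scope classical_set_scope.
Local Open Scope order_scope.
Local Open Scope group_scope.

Definition complete_lattice (d : Order.disp_t) (L : tbLatticeType d) : Prop :=
  forall A : set L, supremums A !=set0 /\ infimums A !=set0.

(* The defaults \bot and \top are the supremum and the infimum of the empty
   set, so in a complete lattice [supremum \bot] and [infimum \top] are the
   actual supremum and infimum of every subset.  The choice functions of the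
   family [J] are the [f : I -> L] with [f i] in [J i] for every [i]. *)
Definition completely_distributive (d : Order.disp_t) (L : tbLatticeType d)
    : Prop :=
  complete_lattice L /\
  forall (I : Type) (J : I -> set L),
    infimum \top (range (fun i => supremum \bot (J i))) =
    supremum \bot [set infimum \top (range f) |
                   f in [set f : I -> L | forall i, J i (f i)]].

Definition supstar (d : Order.disp_t) (L : tbLatticeType d) (X : set L)
    : Prop :=
  X !=set0 /\
  forall A : set L, A `<=` X -> A !=set0 -> exists2 s, supremums A s & A s.

Section LSubsets.
Variables (d : Order.disp_t) (L : tbLatticeType d) (G : groupType).
Implicit Types (mu eta theta : G -> L) (H K : set G).

Definition Lsubset eta mu : Prop := forall x, eta x <= mu x.

Definition level mu (a : L) : set G := [set x | a <= mu x].

Definition Lsubgroup mu : Prop :=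
  (forall x y, mu x `&` mu y <= mu (x * y)) /\ (forall x, mu x^-1 = mu x).

Definition Lsubgroup_of mu eta : Prop := Lsubgroup eta /\ Lsubset eta mu.

Definition proper_Lsubgroup_of mu eta : Prop :=
  [/\ Lsubgroup_of mu eta,
      ~ (exists c, forall x, eta x = c) &
      eta <> mu].

Definition maximal_Lsubgroup_of mu eta : Prop :=
  proper_Lsubgroup_of mu eta /\
  forall theta, Lsubgroup_of mu theta -> Lsubset eta theta ->
    theta = eta \/ theta = mu.

Definition jointly_supstar eta theta : Prop :=
  supstar (range eta `|` range theta).

Definition subgroup H : Prop := group_closed (mem H).

Definition maximal_subgroup_of K H : Prop :=
  [/\ subgroup H, subgroup K, H `<` K &
      forall M, subgroup M -> H `<=` M -> M `<=` K -> M = H \/ M = K].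

End LSubsets.

(* Main.v *)
(* A supstar set is a chain, so the levels of a join of L-subgroups with values
   in it are the unions of the levels.  If [eta] and [mu] had distinct levels
   at both [b] and a larger [a], then [eta \/ (mu /\ b)], whose levels are
   those of [mu] up to [b] and those of [eta] above, would lie strictly between
   [eta] and [mu].  So the levels differ exactly at one value [a0], and a
   subgroup [M] between the levels at [a0] yields the L-subgroup
   [eta \/ a0 1_M] between [eta] and [mu], whose level at [a0] is [M]. *)

Require Import Defs.
From HB Require Import structures.
From mathcomp Require Import all_boot all_order.
From mathcomp Require Import monoid.
From mathcomp Require Import boolp classical_sets.

Set Implicit Arguments.
Unset Strict Implicit.
Unset Printing Implicit Defensive.

Local Open Scope classical_set_scope.
Local Open Scope group_scope.

Import Order.TTheory.

(** The supremum of the pair [[set a; b]] lies in the pair, so it is one of its two elements and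
    dominates the other. *)
Lemma supstar_chain (d : Order.disp_t) (L : tbLatticeType d) (X : set L) :
  supstar X -> total_on X <=%O.
Proof.
move=> [_ supX] a b Xa Xb.
have sub : [set a; b] `<=` X by move=> _ [->|->].
have [s [ub _] [sa|sb]] := supX _ sub (ex_intro _ a (or_introl erefl)).
- by right; rewrite -sa; apply: ub; right.
- by left; rewrite -sb; apply: ub; left.
Qed.

(** Needed for L-subsets supported on a subgroup: their value [\bot] off the subgroup may lie
    outside [X]. *)
Lemma chainU_bot (d : Order.disp_t) (L : tbLatticeType d) (X : set L) :
  total_on X <=%O -> total_on (X `|` [set \bot%O]) <=%O.
Proof.
by move=> chX a b [Xa|->] [Xb|->]; [exact: chX | right | left | left];
  exact: le0x.
Qed.

Lemma chain_join (d : Order.disp_t) (L : latticeType d) (C : set L) a b :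
  total_on C <=%O -> C a -> C b -> C (a `|` b)%O.
Proof.
move=> chC Ca Cb; have [le_ab|le_ba] := chC a b Ca Cb.
- by rewrite (join_idPr le_ab).
- by rewrite (join_idPl le_ba).
Qed.

Lemma chain_meet (d : Order.disp_t) (L : latticeType d) (C : set L) a b :
  total_on C <=%O -> C a -> C b -> C (a `&` b)%O.
Proof.
move=> chC Ca Cb; have [le_ab|le_ba] := chC a b Ca Cb.
- by rewrite (meet_idPl le_ab).
- by rewrite (meet_idPr le_ba).
Qed.

Lemma chain_le_joinP (d : Order.disp_t) (L : latticeType d) (C : set L) a b c :
  total_on C <=%O -> C a -> C b ->
  (c <= a `|` b)%O <-> (c <= a)%O \/ (c <= b)%O.
Proof.
move=> chC Ca Cb; split=> [|[le_ca|le_cb]].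
- have [le_ab|le_ba] := chC a b Ca Cb.
  + by rewrite (join_idPr le_ab); right.
  + by rewrite (join_idPl le_ba); left.
- exact: le_trans le_ca (leUl _ _).
- exact: le_trans le_cb (leUr _ _).
Qed.

Section Levels.
Variables (d : Order.disp_t) (L : tbLatticeType d) (G : groupType).
Implicit Types (mu eta nu : G -> L) (M : set G) (a b c : L).

Lemma subgroupP M :
  subgroup M <-> M 1 /\ forall x y, M x -> M y -> M (x * y^-1).
Proof.
split=> [[M1 MV]|[M1 MV]]; split.
- by move: M1; rewrite ?inE.
- by move=> x y Mx My; have := MV x y; rewrite !inE; apply.
- by rewrite inE.
- by move=> x y; rewrite !inE; apply: MV.
Qed.

Lemma subgroupV M x : subgroup M -> M x -> M x^-1.
Proof. by move=> /group_closedV MV Mx; have := MV x; rewrite !inE; apply. Qed.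

Lemma subgroupM M x y : subgroup M -> M x -> M y -> M (x * y).
Proof.
by move=> /group_closedM MM Mx My; have := MM x y; rewrite !inE; apply.
Qed.

Lemma level_subgroup mu a :
  Lsubgroup mu -> (a <= mu 1)%O -> subgroup (level mu a).
Proof.
move=> [muM muV] a1; apply/subgroupP; split=> // x y ax ay.
by apply: le_trans (muM _ _); rewrite lexI muV ax.
Qed.

Lemma Lsubgroup_meet_const mu b :
  Lsubgroup mu -> Lsubgroup (fun x => (mu x `&` b)%O).
Proof.
move=> [muM muV]; split=> [x y|x]; last by rewrite muV.
rewrite lexI; apply/andP; split; last exact: le_trans (leIl _ _) (leIr _ _).
by apply: le_trans (muM x y); apply: leI2; apply: leIl.
Qed.

Lemma Lsubgroup_indicator M a : subgroup M ->
  Lsubgroup (fun x => if x \in M then a else \bot%O).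
Proof.
move=> sM; split=> [x y|x].
  case: (boolP (x \in M)) => [|_]; last by rewrite meet0x le0x.
  case: (boolP (y \in M)) => [|_]; last by rewrite meetx0 le0x.
  by rewrite !inE => My Mx; rewrite mem_set ?meetxx//; apply: subgroupM.
suff -> : (x^-1 \in M) = (x \in M) by [].
by apply/idP/idP; rewrite !inE => /(subgroupV sM); rewrite ?invgK.
Qed.

(** Levels of the join are unions of levels, and a union of two subgroups need not be a subgroup.
    When the two levels at [c] are comparable, the union is simply the larger one. *)
Lemma Lsubgroup_join (C : set L) eta nu :
    total_on C <=%O -> range eta `<=` C -> range nu `<=` C ->
    Lsubgroup eta -> Lsubgroup nu ->
    (forall c, C c -> level eta c `<=` level nu c \/
                      level nu c `<=` level eta c) ->
  Lsubgroup (fun x => (eta x `|` nu x)%O).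
Proof.
move=> chC Ceta Cnu [etaM etaV] [nuM nuV] cmp.
have CE x : C (eta x) by apply: Ceta; exists x.
have CN x : C (nu x) by apply: Cnu; exists x.
split=> [x y|x]; last by rewrite etaV nuV.
(* [c] is the meet of the values of the join at [x] and [y]. Both points lie in the union of the
   levels at [c], and this is the only level at which comparability is used. *)
set c := (X in (X <= _)%O).
have Cc : C c by apply: (chain_meet chC); apply: (chain_join chC).
have cP z : (c <= eta z `|` nu z)%O -> level eta c z \/ level nu c z.
  by move=> /(chain_le_joinP _ chC (CE z) (CN z)).
have cx := cP x (leIl _ _).
have cy := cP y (leIr _ _).
have [sub|sub] := cmp c Cc.
- have {cx} cx : level nu c x by case: cx => // /sub.
  have {cy} cy : level nu c y by case: cy => // /sub.
  by apply: le_trans (leUr _ _); apply: le_trans (nuM _ _); rewrite lexI cx.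
- have {cx} cx : level eta c x by case: cx => // /sub.
  have {cy} cy : level eta c y by case: cy => // /sub.
  by apply: le_trans (leUl _ _); apply: le_trans (etaM _ _); rewrite lexI cx.
Qed.

Section Maximal.
Variables (mu eta : G -> L) (X : set L).
Hypotheses (chX : total_on X <=%O).
Hypotheses (Xmu : range mu `<=` X) (Xeta : range eta `<=` X).
Hypotheses (mu_subgroup : Lsubgroup mu).
Hypotheses (eta_max : maximal_Lsubgroup_of mu eta).

Let eta_subgroup : Lsubgroup eta.
Proof. by case: eta_max => -[[]]. Qed.

Let le_eta_mu x : (eta x <= mu x)%O.
Proof. by case: eta_max => -[[_ +]] _ _ _; apply. Qed.

(** The join of [eta] and [nu] is an L-subgroup between [eta] and [mu], so maximality makes it one
    of the two. *)
Lemma maximal_Lsubgroup_join nu :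
    range nu `<=` X `|` [set \bot%O] -> Lsubgroup nu -> Lsubset nu mu ->
    (forall c, X c -> level eta c `<=` level nu c \/
                      level nu c `<=` level eta c) ->
  Lsubset nu eta \/ (forall x, eta x `|` nu x = mu x)%O.
Proof.
move=> Xnu snu le_nu cmp.
have sj : Lsubgroup (fun x => (eta x `|` nu x)%O).
  apply: (Lsubgroup_join (chainU_bot chX)) => //.
    by move=> c /Xeta; left.
  by move=> c [/cmp//|->]; left=> x _; rewrite /level /= le0x.
have le_j : Lsubset (fun x => (eta x `|` nu x)%O) mu.
  by move=> x; rewrite leUx le_eta_mu le_nu.
have [|eqj|eqj] := eta_max.2 _ (conj sj le_j); first by move=> x; exact: leUl.
- by left=> x; rewrite -eqj; exact: leUr.
- by right=> x; rewrite -eqj.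
Qed.

(** Used in both orders, this forces [a = b]: the levels differ at no more than one value of [X]. *)
Lemma level_neq_le a b : X a -> X b ->
  level eta a <> level mu a -> level eta b <> level mu b -> (a <= b)%O.
Proof.
move=> Xa Xb neqa neqb; have [//|le_ba] := chX Xa Xb.
have Xm x : X (mu x) by apply: Xmu; exists x.
have [||||sub|eqmu] := @maximal_Lsubgroup_join (fun x => (mu x `&` b)%O).
- by move=> _ [x _ <-]; left; apply: (chain_meet chX).
- exact: Lsubgroup_meet_const.
- by move=> x; exact: leIl.
(* Up to [b] the truncation of [mu] has the levels of [mu], which contain those of [eta]; strictly
   above [b] its levels are empty. *)
- move=> c Xc; have [le_cb|le_bc] := chX Xc Xb.
    by left=> x /= cx; rewrite /level /= lexI le_cb (le_trans cx).
  have [->|neq] := eqVneq c b.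
    by left=> x /= cx; rewrite /level /= lexI lexx (le_trans cx).
  right=> x; rewrite /level /= lexI => /andP[_ le_cb].
  by move: neq; rewrite (le_anti (introT andP (conj le_cb le_bc))) eqxx.
- case: neqb; apply/seteqP; split=> x /= bx; first exact: le_trans bx _.
  by apply: le_trans (sub x); rewrite lexI bx lexx.
(* If the join is [mu] and [b] is strictly below [a], the summand bounded by [b] cannot reach [a],
   so the level of [mu] at [a] comes from [eta] alone. *)
- have [->//|neq] := eqVneq a b.
  case: neqa; apply/seteqP; split=> x /= ax; first exact: le_trans ax _.
  move: ax; rewrite /level /= -eqmu.
  case/(chain_le_joinP _ chX _ (chain_meet chX (Xm x) Xb)).
  + by apply: Xeta; exists x.
  + by [].
  + rewrite lexI => /andP[_ le_ab].
    by move: neq; rewrite (le_anti (introT andP (conj le_ab le_ba))) eqxx.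
Qed.

(** The bound [a <= eta 1] puts the identity in both levels, which makes them subgroups. *)
Lemma level_neq_maximal a : X a -> (a <= eta 1)%O ->
  level eta a <> level mu a ->
  maximal_subgroup_of (level mu a) (level eta a).
Proof.
move=> Xa a1 neqa.
have sub_eta_mu c : level eta c `<=` level mu c.
  by move=> x cx; apply: le_trans cx _.
have smu_a : subgroup (level mu a).
  by apply: level_subgroup => //; apply: le_trans a1 _.
split=> //; first exact: level_subgroup.
  by rewrite properEneq; split=> //; apply/eqP.
move=> M sM etaM Mmu; pose nu x := if x \in M then a else \bot%O.
have nuE x : M x -> nu x = a by move=> Mx; rewrite /nu mem_set.
have [||||sub|eqmu] := @maximal_Lsubgroup_join nu.
- by move=> _ [x _ <-]; rewrite /nu; case: ifP; [left | right].
- exact: Lsubgroup_indicator.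
- move=> x; rewrite /nu; case: ifP => [|_]; last exact: le0x.
  by rewrite inE => /Mmu.
- move=> c Xc; have [->|neq] := eqVneq c a.
    by left=> x /etaM Mx; rewrite /level /= nuE.
  right=> x; rewrite /level /= /nu; case: ifP => [|_ c0]; last first.
    by apply: le_trans c0 (le0x _).
  (* Here [c] is strictly below [a]. Distinct levels at [c] would give [a <= c] by [level_neq_le],
     so the levels of [eta] and [mu] at [c] agree. *)
  rewrite inE => /Mmu ax le_ca; suff eqc : level eta c = level mu c.
    have : level mu c x by apply: le_trans le_ca ax.
    by rewrite -eqc.
  apply: contrapT => neqc; move/eqP: neq; apply.
  by apply: le_anti; rewrite le_ca level_neq_le.
- left; apply/seteqP; split=> // x Mx.
  by rewrite /level /= -(nuE x Mx).
- right; apply/seteqP; split=> // x /=; rewrite /level /= -eqmu.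
  have Xnu : (X `|` [set \bot%O]) (nu x).
    by rewrite /nu; case: ifP; [left | right].
  have Xe : (X `|` [set \bot%O]) (eta x) by left; apply: Xeta; exists x.
  case/(chain_le_joinP _ (chainU_bot chX) Xe Xnu) => [/etaM//|].
  (* Off [M] the inequality reads [a <= \bot]; then the level of [eta] at [a] is the whole group,
     and so is [M]. *)
  rewrite /nu; case: ifP => [|_ a0]; first by rewrite inE.
  by apply: etaM; apply: le_trans a0 (le0x _).
Qed.

End Maximal.
End Levels.

Theorem theorem3p7 (d : Order.disp_t) (L : tbLatticeType d)
    (L_cd : completely_distributive L) (G : groupType) (mu eta : G -> L)
    (mu_subgroup : Lsubgroup mu) (eta_in : Lsubgroup_of mu eta)
    (supstar_mu_eta : jointly_supstar mu eta)
    (eta_max : maximal_Lsubgroup_of mu eta)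
    (eta_mu_e : eta 1 = mu 1) :
  exists a0 : L,
    unique (fun a => range mu a /\
                     maximal_subgroup_of (level mu a) (level eta a)) a0 /\
    forall a : L, (range mu `|` range eta) a -> a <> a0 ->
      level eta a = level mu a.
Proof.
have chX := supstar_chain supstar_mu_eta.
have Xmu : range mu `<=` range mu `|` range eta by left.
have Xeta : range eta `<=` range mu `|` range eta by right.
(* The required value is [mu x] at any point [x] where [eta] and [mu] differ: [x] lies in the level
   of [mu] there but not in that of [eta]. *)
have [x neq_x] : exists x, eta x <> mu x.
  apply: contrapT => eq_x; have [[_ _ neq_mu] _] := eta_max.
  apply: neq_mu; apply/funext => x.
  by apply: contrapT => neq; apply: eq_x; exists x.
have neq0 : level eta (mu x) <> level mu (mu x).
  move=> eq_level; have : level mu (mu x) x by exact: lexx.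
  rewrite -eq_level => le_mu_eta; apply: neq_x.
  by apply: le_anti; rewrite (eta_in.2 x).
have X0 : (range mu `|` range eta) (mu x) by left; exists x.
have uniq0 a : (range mu `|` range eta) a ->
    level eta a <> level mu a -> a = mu x.
  move=> Xa neqa; apply: le_anti.
  by rewrite !(level_neq_le chX Xmu Xeta mu_subgroup eta_max).
have mu_x1 : (mu x <= eta 1)%O.
  by rewrite eta_mu_e -(mulgV x) (le_trans _ (mu_subgroup.1 _ _))//
    mu_subgroup.2 lexI lexx.
exists (mu x); split; last first.
  by move=> a Xa neqa; apply: contrapT => /(uniq0 a Xa).
split.
  by split; [exists x | exact: (level_neq_maximal chX Xmu)].
(* A maximal subgroup is proper, so the levels at [a] differ and [uniq0] applies. *)
move=> a [a_mu [_ _ [_ not_sub] _]]; apply/esym/uniq0; first by left.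
by move=> eq_level; apply: not_sub; rewrite eq_level.
Qed.
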